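(* Let $\ell\in\mathbb{N}$, let $p(x,y)\in\{y(x-y^\ell),\,x(y-x^\ell)\}$, and suppose that $n\ge\ell+1$. Then every $f\in\mathcal{P}_{2n}$ that is strictly positive on $\mathcal{Z}_p$ admits a representation $$f=\sum_{j=1}^r g_j^2+ph,$$ where $g_1,\ldots,g_r,h\in\mathbb{R}[x,y]$ and $g_j^2,\ ph\in\mathcal{P}_{2\left(n+\ell+\max\{\ell-1,2\}\right)}$ for $j=1,\ldots,r$.
   Context: Here $\mathbb{N}=\{1,2,\ldots\}$, $\mathcal{P}_m=\{f\in\mathbb{R}[x,y]:\deg f\le m\}$, and $\mathcal{Z}_p=\{(x,y)\in\mathbb{R}^2:p(x,y)=0\}$. *)

(* Defs.v *)
From HB Require Import structures.
From mathcomp Require Import all_boot all_order all_algebra.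
From mathcomp Require Import reals mpoly.
Set Implicit Arguments.
Unset Strict Implicit.
Unset Printing Implicit Defensive.
Import Order.TTheory GRing.Theory Num.Theory.
Local Open Scope ring_scope.

(* R[x, y] is {mpoly R[2]}: x is the variable of index 0, y that of index 1. *)
Definition polyx (R : realType) : {mpoly R[2]} := 'X_(ord0 : 'I_2).
Definition polyy (R : realType) : {mpoly R[2]} := 'X_(ord_max : 'I_2).

(* msize f is the total degree of f plus one, and msize 0 = 0, so that the zero
   polynomial belongs to every deg_le m. *)
Definition deg_le (R : realType) (m : nat) (f : {mpoly R[2]}) : Prop :=
  (msize f <= m.+1)%N.

Definition zero_locus (R : realType) (p : {mpoly R[2]}) (v : 'I_2 -> R) : Prop :=
  p.@[v] = 0.

(* Main.v *)
Require Import Defs.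
From HB Require Import structures.
From mathcomp Require Import all_boot all_order all_algebra.
From mathcomp Require Import reals mpoly complex ring zify.

(** After naming the two variables [U] and [V] in the right order, the curve is
    [V * (U - V ^ l) = 0]: the union of the axis [V = 0], parametrised by
    [s |-> (s, 0)], and the smooth arc [U = V ^ l], parametrised by
    [t |-> (t ^ l, t)].  The two components cross transversally at the origin,
    so the coordinate ring of the curve is the ring of pairs [(a, b)] of
    univariate polynomials with [a(0) = b(0)].

    Restricting [f] gives such a pair, with [a] of degree at most [2n], [b] of
    degree at most [2ln], and both strictly positive on the line.  A positive
    univariate polynomial is a sum of two squares ([pos_poly_sos2]), say
    [a = a1^2 + a2^2] and [b = b1^2 + b2^2].  The vectors [(a1(0), a2(0))] and
    [(b1(0), b2(0))] have the same length because [a(0) = b(0)], and rotating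
    [(b1, b2)] by a constant angle does not change [b1^2 + b2^2]; so one may
    choose [b1], [b2] with [bi(0) = ai(0)] ([pos_poly_sos2_at0]).  Then
    [(a1, b1)] and [(a2, b2)] are elements of the coordinate ring, and two
    squares suffice.

    The degree bound comes from lifting these pairs economically
    ([axis_arc_lift]): on the arc [t ^ (l * i + j) = U ^ i * V ^ j], so a power
    of [t] of exponent at most [l * n] is the restriction of a monomial of
    degree at most [n + l - 1].  Finally [f - g1^2 - g2^2] vanishes on both
    components, hence is a multiple of the equation ([axis_arc_dvd]), and the
    degree of that multiple is bounded by those of [f] and of the squares. *)

Set Implicit Arguments.
Unset Strict Implicit.
Unset Printing Implicit Defensive.
Import Order.TTheory GRing.Theory Num.Theory.
Local Open Scope ring_scope.

(** * Positive univariate polynomials as sums of two squares *)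

(** A complex root [u + iv] of [b] is a root of the real quadratic below; the
    remainder of [b] modulo this quadratic is real, of degree at most one, and
    vanishes at a non-real point, so it is zero. *)
Lemma rootfree_quadratic_factor (R : rcfType) (b : {poly R}) :
    (1 < size b)%N -> (forall t, b.[t] != 0) ->
  exists u v (q : {poly R}), b = q * (('X - u%:P) ^+ 2 + (v ^+ 2)%:P).
Proof.
move=> szb b_neq0.
have : size (map_poly (real_complex R) b) != 1%N by rewrite size_map_poly gtn_eqF.
case/closed_rootP=> -[u v] /rootP bz.
exists u, v.
set q0 := _ + _.
have sz2 : size (('X - u%:P) ^+ 2) = 3%N by rewrite size_exp_XsubC.
have szq0 : size q0 = 3%N.
  by rewrite size_polyDl sz2 // (leq_ltn_trans (size_polyC_leq1 _)).
have q0z : (map_poly (real_complex R) q0).[(u +i* v)%C] = 0.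
  rewrite /q0 rmorphD rmorphXn rmorphB /= map_polyX !map_polyC /= !hornerE /=.
  by apply/eqP; rewrite eq_complex /=; apply/andP; split; apply/eqP; ring.
have szr : (size (b %% q0)%R <= 2)%N.
  by rewrite -ltnS -szq0 ltn_modp -size_poly_eq0 szq0.
pose r0 := (b %% q0)`_0; pose r1 := (b %% q0)`_1.
have rz : (map_poly (real_complex R) (b %% q0)).[(u +i* v)%C] = 0.
  by move: bz; rewrite {1}(divp_eq b q0) rmorphD rmorphM /= hornerD hornerM q0z mulr0 add0r.
have {rz} : (map_poly (real_complex R) (r1 *: 'X + r0%:P)).[(u +i* v)%C] = 0.
  rewrite -[RHS]rz; congr (map_poly _ _).[_]; apply/polyP => -[|[|i]].
  - by rewrite coefD coefZ coefX coefC mulr0 add0r.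
  - by rewrite coefD coefZ coefX coefC mulr1 addr0.
  - by rewrite coefD coefZ coefX coefC mulr0 addr0 nth_default // (leq_trans szr).
rewrite rmorphD /= map_polyZ map_polyX map_polyC /= !hornerE.
move=> /eqP; rewrite eq_complex /= => /andP [/eqP re /eqP im].
have v_neq0 : v != 0.
  apply: contraNneq (b_neq0 u) => v0; move: bz; rewrite v0 complexr0 horner_map.
  by case=> /eqP.
have r1_eq0 : r1 = 0.
  have {}im : r1 * v = 0 by rewrite -[RHS]im; ring.
  by apply/eqP; move/eqP: im; rewrite mulf_eq0 (negPf v_neq0) orbF.
have r0_eq0 : r0 = 0 by rewrite -[RHS]re r1_eq0; ring.
have r_eq0 : b %% q0 = 0.
  apply/polyP => -[|[|i]]; rewrite coef0 //.
  by rewrite nth_default // (leq_trans szr).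
by exists (b %/ q0); rewrite {1}(divp_eq b q0) r_eq0 addr0.
Qed.

Lemma pos_const_sqr (R : rcfType) (b : {poly R}) :
    (size b <= 1)%N -> (forall t, 0 < b.[t]) ->
  exists2 c : {poly R}, b = c ^+ 2 & (size c <= 1)%N.
Proof.
move=> sz1 b_gt0; exists (Num.sqrt b.[0])%:P; last exact: size_polyC_leq1.
rewrite -rmorphXn /= sqr_sqrtr ?ltW //.
by rewrite {1 2}(size1_polyC sz1) hornerC.
Qed.

(** Split off one quadratic factor [(X - u)^2 + v^2] at a time and use that
    sums of two squares are closed under products (the two-square identity).
    Each factor raises the degree of [b] by two and those of the two roots by
    one. *)
Lemma pos_poly_sos2 (R : rcfType) (n : nat) (b : {poly R}) :
    (size b <= n.*2.+1)%N -> (forall t, 0 < b.[t]) ->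
  exists c d : {poly R},
    [/\ b = c ^+ 2 + d ^+ 2, (size c <= n.+1)%N & (size d <= n.+1)%N].
Proof.
elim: n b => [|n IHn] b szb b_gt0; have [sz1 | sz1] := leqP (size b) 1.
- have [c cE szc] := pos_const_sqr sz1 b_gt0.
  by exists c, 0; rewrite cE expr0n addr0 size_poly0 szc.
- by rewrite leqNgt sz1 in szb.
- have [c cE szc] := pos_const_sqr sz1 b_gt0.
  by exists c, 0; rewrite cE expr0n addr0 size_poly0 (leq_trans szc).
have [|u [v [q bE]]] := rootfree_quadratic_factor sz1.
  by move=> t; rewrite gt_eqF.
have b_neq0 : b != 0 by rewrite -size_poly_gt0 ltnW.
have q_neq0 : q != 0 by apply: contraNneq b_neq0 => q0; rewrite bE q0 mul0r.
have sz2 : size (('X - u%:P) ^+ 2) = 3%N by rewrite size_exp_XsubC.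
have szq0 : size (('X - u%:P) ^+ 2 + (v ^+ 2)%:P) = 3%N.
  by rewrite size_polyDl sz2 // (leq_ltn_trans (size_polyC_leq1 _)).
have szq : (size q <= n.*2.+1)%N.
  move: szb; rewrite bE size_mul // -?size_poly_eq0 ?szq0 // addn3 /=.
  by rewrite doubleS !ltnS.
have q_gt0 t : 0 < q.[t].
  have := b_gt0 t; rewrite bE !hornerE pmulr_lgt0 //.
  rewrite lt_neqAle addr_ge0 ?sqr_ge0 // andbT eq_sym.
  apply: contraTneq (b_gt0 t) => e.
  by rewrite bE !hornerE e mulr0 ltxx.
have [c [d [qE szc szd]]] := IHn q szq q_gt0.
have szX (e : {poly R}) : (size e <= n.+1)%N -> (size (e * ('X - u%:P))%R <= n.+2)%N.
  move=> sze; rewrite (leq_trans (size_polyMleq _ _)) // size_XsubC addn2 /=.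
  by rewrite ltnS.
have szC (e : {poly R}) : (size e <= n.+1)%N -> (size (v *: e)%R <= n.+2)%N.
  by move=> sze; rewrite (leq_trans (size_scale_leq _ _)) // ltnW.
exists (c * ('X - u%:P) + v *: d), (v *: c - d * ('X - u%:P)); split.
- by rewrite bE qE -!mul_polyC rmorphXn /=; ring.
- by rewrite (leq_trans (size_polyD _ _)) // geq_max szX ?szC.
- by rewrite (leq_trans (size_polyD _ _)) // geq_max size_polyN szX ?szC.
Qed.

(** Any representation as a sum of two squares can be rotated: the prescribed
    values at 0 and the actual ones are two vectors of the same length. *)
Lemma pos_poly_sos2_at0 (R : rcfType) (n : nat) (b : {poly R}) (x y : R) :
    (size b <= n.*2.+1)%N -> (forall t, 0 < b.[t]) ->
    b.[0] = x ^+ 2 + y ^+ 2 ->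
  exists c d : {poly R},
    [/\ b = c ^+ 2 + d ^+ 2, (size c <= n.+1)%N, (size d <= n.+1)%N,
        c.[0] = x & d.[0] = y].
Proof.
move=> szb b_gt0 b0; have [c [d [bE szc szd]]] := pos_poly_sos2 szb b_gt0.
have cd0 : c.[0] ^+ 2 + d.[0] ^+ 2 = b.[0] by rewrite bE !hornerE.
have b0_neq0 : b.[0] != 0 by rewrite gt_eqF.
(* [k] and [s] are the cosine and sine of the angle between the two vectors. *)
pose k := (x * c.[0] + y * d.[0]) / b.[0].
pose s := (x * d.[0] - y * c.[0]) / b.[0].
have ks : k ^+ 2 + s ^+ 2 = 1.
  rewrite -(divff (mulf_neq0 b0_neq0 b0_neq0)) {1}b0 -{1}cd0 /k /s.
  by field.
have sz_lin (i j : R) : (size (i *: c + j *: d)%R <= n.+1)%N.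
  rewrite (leq_trans (size_polyD _ _)) // geq_max.
  by rewrite !(leq_trans (size_scale_leq _ _)).
exists (k *: c + s *: d), ((- s) *: c + k *: d); split => //.
- rewrite bE -[LHS]mul1r -(rmorph1 (@polyC R)) -ks -!mul_polyC rmorphN rmorphD !rmorphXn /=.
  by ring.
- by rewrite !hornerE -[RHS](mulfK b0_neq0) -{1}cd0 /k /s; field.
- by rewrite !hornerE -[RHS](mulfK b0_neq0) -{1}cd0 /k /s; field.
Qed.

(** * Restricting polynomials to parametrised curves *)

Local Notation pullback := (mmap (@polyC _)).

Lemma pullbackX (n : nat) (R : comNzRingType) (phi : 'I_n -> {poly R}) i :
  pullback phi 'X_i = phi i.
Proof. by rewrite mmapX mmap1U. Qed.

Lemma pullbackZ (n : nat) (R : comNzRingType) (phi : 'I_n -> {poly R}) c f :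
  pullback phi (c *: f) = c *: pullback phi f.
Proof. by rewrite mmapZ mul_polyC. Qed.

Lemma horner_pullback (n : nat) (R : comNzRingType) (phi : 'I_n -> {poly R}) f t :
  (pullback phi f).[t] = f.@[fun i => (phi i).[t]].
Proof.
rewrite mevalE /mmap horner_sum; apply: eq_bigr => m _.
rewrite hornerM hornerC /mmap1 horner_prod; congr (_ * _).
by apply: eq_bigr => i _; rewrite horner_exp.
Qed.

Lemma size_pullback (n : nat) (R : idomainType) (phi : 'I_n -> {poly R}) k d f :
    (forall i, (size (phi i) <= k.+1)%N) -> (msize f <= d.+1)%N ->
  (size (pullback phi f) <= (k * d).+1)%N.
Proof.
move=> szphi szf; rewrite /mmap big_seq.
elim/big_ind: _ => [|p q szp szq|m m_f]; first by rewrite size_poly0.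
  by rewrite (leq_trans (size_polyD _ _)) // geq_max szp szq.
rewrite mul_polyC (leq_trans (size_scale_leq _ _)) // /mmap1.
have szm : (size (\prod_(i < n) phi i ^+ m i)%R <= (k * mdeg m).+1)%N.
  rewrite mdegE; elim/big_ind2: _ => [|p a q b szp szq|i _].
  - by rewrite size_poly1.
  - rewrite (leq_trans (size_polyMleq _ _)) // mulnDr.
    by move: szp szq; lia.
  - rewrite (leq_trans (size_poly_exp_leq _ _)) // ltnS leq_mul2r.
    by have := szphi i; lia.
rewrite (leq_trans szm) // ltnS leq_mul2l -ltnS (leq_trans _ szf) ?orbT //.
exact: msize_mdeg_lt.
Qed.

Definition in_var (n : nat) (R : comNzRingType) (i : 'I_n) (a : {poly R}) :
  {mpoly R[n]} := (map_poly (@mpolyC n R) a).['X_i].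

Lemma pullback_in_var (n : nat) (R : comNzRingType) (phi : 'I_n -> {poly R}) i a :
  pullback phi (in_var i a) = a \Po phi i.
Proof.
rewrite /in_var -horner_map /= pullbackX -map_poly_comp /comp_poly.
by congr _.[_]; apply: eq_map_poly => c /=; rewrite mmapC.
Qed.

(** * The union of an axis and an arc of power type *)

Lemma mpolyX2E (R : comNzRingType) (u v : 'I_2) (m : 'X_{1..2}) :
  u != v -> 'X_[m] = 'X_u ^+ m u * 'X_v ^+ m v :> {mpoly R[2]}.
Proof.
move=> uv; rewrite mpolyXE_id big_ord_recl big_ord1.
suff [[-> ->]|[-> ->]] : ord0 = u /\ lift ord0 ord0 = v \/ ord0 = v /\ lift ord0 ord0 = u => //.
  by rewrite mulrC.
by case: u v uv => -[|[|[]]] // i [] [|[|[]]] // j _; [left|right]; split; apply: val_inj.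
Qed.

Lemma msize_scale_mon2 (R : comNzRingType) (u v : 'I_2) c i j :
  (msize (c *: ('X_u ^+ i * 'X_v ^+ j) : {mpoly R[2]}) <= (i + j).+1)%N.
Proof.
rewrite (leq_trans (msizeZ_le _ _)) // !mpolyXn -mpolyXD msizeX.
by rewrite mdegD !mdegMn !mdeg1 !mul1n.
Qed.

Lemma msize_sum_le (n : nat) (R : nzRingType) (I : finType) (F : I -> {mpoly R[n]}) d :
  (forall i, (msize (F i) <= d)%N) -> (msize (\sum_i F i) <= d)%N.
Proof.
by move=> szF; rewrite (leq_trans (msize_sum _ _ _)) //; apply/bigmax_leqP.
Qed.

Lemma msize_in_var (R : comNzRingType) (u : 'I_2) (a : {poly R}) d :
  (size a <= d)%N -> (msize (in_var u a) <= d)%N.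
Proof.
move=> sza; rewrite /in_var (horner_coef_wide (n := d)); last first.
  by rewrite (leq_trans (size_poly _ _)).
apply: msize_sum_le => i; rewrite coef_map /= mul_mpolyC -[X in _ *: X]mulr1.
rewrite -(expr0 'X_u) (leq_trans (msize_scale_mon2 _ _ _ _ _)) //.
by rewrite addn0.
Qed.

Lemma msize_sqr_le (n : nat) (R : idomainType) (g : {mpoly R[n]}) d :
  (msize g <= d.+1)%N -> (msize (g ^+ 2) <= (2 * d).+1)%N.
Proof.
have [->|g_neq0] := eqVneq g 0; first by rewrite expr0n msize0.
by rewrite expr2 msizeM //; lia.
Qed.

Definition axis (R : comNzRingType) (u : 'I_2) : 'I_2 -> {poly R} :=
  fun i => if i == u then 'X else 0.

Definition power_arc (R : comNzRingType) (l : nat) (u : 'I_2) : 'I_2 -> {poly R} :=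
  fun i => if i == u then 'X^l else 'X.

Definition axis_arc (R : nzRingType) (l : nat) (u v : 'I_2) : {mpoly R[2]} :=
  'X_v * ('X_u - 'X_v ^+ l).

(** Modulo the equation one has [U * V = V ^ l.+1], which trades every mixed
    monomial [U ^ i * V ^ j.+1] for the power [V ^ (l * i + j).+1]; only pure
    powers remain. *)
Lemma axis_arc_normal_form (R : comNzRingType) (l : nat) (u v : 'I_2) (f : {mpoly R[2]}) :
    u != v ->
  exists (a b : {poly R}) (h : {mpoly R[2]}),
    f = in_var u a + 'X_v * in_var v b + axis_arc R l u v * h.
Proof.
move=> uv; elim/mpolyind: f => [|c m f _ _ [a [b [h ->]]]].
  by exists 0, 0, 0; rewrite /in_var !rmorph0 !horner0 !mulr0 !addr0.
suff [a' [b' [h' ->]]] : exists (a b : {poly R}) (h : {mpoly R[2]}),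
    c *: 'X_[m] = in_var u a + 'X_v * in_var v b + axis_arc R l u v * h.
  exists (a' + a), (b' + b), (h' + h).
  by rewrite /in_var !rmorphD /= !hornerD; ring.
have in_var_mon i k : in_var i (c *: 'X^k) = c%:MP_[2] * 'X_i ^+ k.
  by rewrite /in_var map_polyZ map_polyXn hornerZ hornerXn.
rewrite (mpolyX2E _ _ uv) -mul_mpolyC.
case: (m v) => [|j].
  exists (c *: 'X^(m u)), 0, 0.
  by rewrite in_var_mon /in_var rmorph0 horner0; ring.
(* The cofactor comes from the factorisation of [U ^ i - (V ^ l) ^ i]. *)
exists 0, (c *: 'X^(l * m u + j)).
exists (c%:MP * 'X_v ^+ j * \sum_(i < m u) 'X_u ^+ ((m u).-1 - i) * ('X_v ^+ l) ^+ i).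
rewrite in_var_mon /in_var rmorph0 horner0 add0r.
transitivity (c%:MP_[2] * ('X_v ^+ j * 'X_v * ('X_u ^+ m u - ('X_v ^+ l) ^+ m u
   + ('X_v ^+ l) ^+ m u))).
  by rewrite subrK exprSr; ring.
by rewrite subrXX -exprM exprD /axis_arc; ring.
Qed.

(** A polynomial in normal form is determined by its two restrictions, so the
    equation generates the vanishing ideal of the curve. *)
Lemma axis_arc_dvd (R : comNzRingType) (l : nat) (u v : 'I_2) (f : {mpoly R[2]}) :
    u != v -> pullback (axis R u) f = 0 -> pullback (power_arc R l u) f = 0 ->
  exists h, f = axis_arc R l u v * h.
Proof.
move=> uv; have [a [b [h ->]]] := axis_arc_normal_form l f uv.
have vu : (v == u) = false by rewrite eq_sym (negPf uv).
rewrite /axis_arc !rmorphD !rmorphM !rmorphB !rmorphXn /= !pullback_in_var !pullbackX.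
rewrite /axis /power_arc eqxx vu subrr !mul0r !mulr0 ?mul0r !addr0 comp_polyXr => ->.
rewrite comp_poly0 add0r comp_polyXr mulrC => bX0.
have -> : b = 0.
  by apply/polyP => i; have /polyP/(_ i.+1) := bX0; rewrite coefMX !coef0.
by exists h; rewrite /in_var rmorph0 !horner0 mulr0 !add0r.
Qed.

(** The lift uses the relation [U * V = V ^ l.+1] in the direction opposite to
    [axis_arc_normal_form]: powers of the arc parameter are written with
    as few factors [V] as possible.  At least one factor [V] is kept, so that
    the correction along the arc does not affect the axis. *)
Lemma axis_arc_lift (R : comNzRingType) (l n : nat) (u v : 'I_2) (a b : {poly R}) :
    (0 < l)%N -> u != v -> a.[0] = b.[0] ->
    (size a <= n.+1)%N -> (size b <= (l * n).+1)%N ->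
  exists g : {mpoly R[2]},
    [/\ pullback (axis R u) g = a, pullback (power_arc R l u) g = b &
        (msize g <= n + l)%N].
Proof.
move=> l_gt0 uv ab0 sza szb.
have vu : (v == u) = false by rewrite eq_sym (negPf uv).
(* [in_var u a] already has the right restriction to the axis; [d] is what its
   restriction to the arc lacks, and it vanishes at the origin. *)
pose d := b - (a \Po 'X^l).
have szd : (size d <= (l * n).+1)%N.
  rewrite /d (leq_trans (size_polyD _ _)) // geq_max szb size_polyN.
  rewrite (leq_trans (size_comp_poly_leq _ _)) // size_polyXn /= ltnS [(l * n)%N]mulnC.
  by rewrite leq_mul // -subn1 leq_subLR.
have d0 : d`_0 = 0.
  by rewrite -horner_coef0 /d hornerD hornerN horner_comp hornerXn expr0n
     gtn_eqF //= ab0 subrr.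
pose g0 : {mpoly R[2]} :=
  \sum_(k < l * n) d`_k.+1 *: ('X_u ^+ (k %/ l) * 'X_v ^+ (k %% l).+1).
exists (in_var u a + g0); split.
- rewrite rmorphD /= pullback_in_var /axis eqxx comp_polyXr /g0 rmorph_sum /= big1 ?addr0 // => k _.
  by rewrite pullbackZ rmorphM !rmorphXn /= !pullbackX vu expr0n mulr0 scaler0.
- rewrite rmorphD /= pullback_in_var /power_arc eqxx -[RHS](subrKC (a \Po 'X^l)).
  congr (_ + _); rewrite -/d /g0 rmorph_sum /=.
  under eq_bigr => k _.
    rewrite pullbackZ rmorphM !rmorphXn /= !pullbackX eqxx vu -exprM -exprD.
    rewrite addnS [(l * (k %/ l))%N]mulnC -divn_eq; over.
  have dE : d = \poly_(i < (l * n).+1) d`_i.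
    apply/polyP => i; rewrite coef_poly; case: ltnP => // i_ge.
    by rewrite nth_default // (leq_trans szd).
  by rewrite [RHS]dE poly_def big_ord_recl d0 scale0r add0r.
- rewrite (leq_trans (msizeD_le _ _)) // geq_max msize_in_var ?(leq_trans sza) //; last first.
    by rewrite -addn1 leq_add2l.
  apply: msize_sum_le => k; rewrite (leq_trans (msize_scale_mon2 _ _ _ _ _)) //.
  by rewrite -addSn leq_add ?ltn_pmod // ltn_divLR // [(n * l)%N]mulnC.
Qed.

(** The square roots are found on each component separately, those on the arc
    with values at the origin prescribed by those on the axis; this is exactly
    what makes each pair lift to the plane. *)
Lemma pos_on_axis_arc_sos (R : rcfType) (l n : nat) (u v : 'I_2) (f : {mpoly R[2]}) :
    (0 < l)%N -> u != v -> (msize f <= (2 * n).+1)%N ->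
    (forall x, (axis_arc R l u v).@[x] = 0 -> 0 < f.@[x]) ->
  exists g1 g2 h : {mpoly R[2]},
    [/\ f = g1 ^+ 2 + g2 ^+ 2 + axis_arc R l u v * h,
        (msize g1 <= n + l)%N & (msize g2 <= n + l)%N].
Proof.
move=> l_gt0 uv szf f_gt0.
have vu : (v == u) = false by rewrite eq_sym (negPf uv).
pose a := pullback (axis R u) f; pose b := pullback (power_arc R l u) f.
have a_gt0 t : 0 < a.[t].
  rewrite horner_pullback; apply: f_gt0.
  by rewrite /axis_arc mevalM !mevalXU /axis vu horner0 mul0r.
have b_gt0 t : 0 < b.[t].
  rewrite horner_pullback; apply: f_gt0.
  rewrite /axis_arc rmorphM rmorphB rmorphXn /= !mevalXU /power_arc eqxx vu.
  by rewrite hornerXn hornerX subrr mulr0.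
have ab0 : a.[0] = b.[0].
  rewrite !horner_pullback; apply: meval_eq => i; rewrite /axis /power_arc.
  by case: eqP => _; rewrite ?hornerXn !hornerX ?horner0 // expr0n gtn_eqF.
have sza : (size a <= n.*2.+1)%N.
  rewrite -mul2n -[(2 * n)%N]mul1n.
  by apply: size_pullback szf => i; rewrite /axis; case: eqP; rewrite ?size_polyX ?size_poly0.
have szb : (size b <= (l * n).*2.+1)%N.
  rewrite -mul2n mulnCA; apply: size_pullback szf => i.
  by rewrite /power_arc; case: eqP; rewrite ?size_polyXn ?size_polyX.
have [a1 [a2 [aE sza1 sza2]]] := pos_poly_sos2 sza a_gt0.
have b0E : b.[0] = a1.[0] ^+ 2 + a2.[0] ^+ 2 by rewrite -ab0 aE !hornerE.
have [b1 [b2 [bE szb1 szb2 b10 b20]]] := pos_poly_sos2_at0 szb b_gt0 b0E.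
have [g1 [g1a g1b szg1]] := axis_arc_lift l_gt0 uv (esym b10) sza1 szb1.
have [g2 [g2a g2b szg2]] := axis_arc_lift l_gt0 uv (esym b20) sza2 szb2.
have [||h fE] := @axis_arc_dvd R l u v (f - (g1 ^+ 2 + g2 ^+ 2)) uv.
- by rewrite rmorphB rmorphD !rmorphXn /= g1a g2a -aE subrr.
- by rewrite rmorphB rmorphD !rmorphXn /= g1b g2b -bE subrr.
by exists g1, g2, h; rewrite -fE subrKC.
Qed.

Theorem corollary4p7 (R : realType) (l : nat) (hl : (1 <= l)%N)
  (p : {mpoly R[2]})
  (hp : p = polyy R * (polyx R - polyy R ^+ l) \/
        p = polyx R * (polyy R - polyx R ^+ l))
  (n : nat) (hn : (l + 1 <= n)%N)
  (f : {mpoly R[2]}) (hf : deg_le (2 * n) f)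
  (hpos : forall v : 'I_2 -> R, zero_locus p v -> 0 < f.@[v]) :
  exists (r : nat) (g : 'I_r -> {mpoly R[2]}) (h : {mpoly R[2]}),
    [/\ f = \sum_(j < r) g j ^+ 2 + p * h,
        forall j : 'I_r, deg_le (2 * (n + l + maxn (l - 1) 2)) (g j ^+ 2) &
        deg_le (2 * (n + l + maxn (l - 1) 2)) (p * h)].
Proof.
have [u [v [uv pE]]] : exists u v : 'I_2, u != v /\ p = axis_arc R l u v.
  by case: hp => ->; [exists ord0, ord_max | exists ord_max, ord0].
have f_gt0 x : (axis_arc R l u v).@[x] = 0 -> 0 < f.@[x].
  by rewrite -pE; apply: hpos.
have [g1 [g2 [h [fE szg1 szg2]]]] := pos_on_axis_arc_sos hl uv hf f_gt0.
rewrite -pE in fE.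
set d := (n + l + maxn (l - 1) 2)%N.
have sqr_le (g : {mpoly R[2]}) : (msize g <= n + l)%N -> deg_le (2 * d) (g ^+ 2).
  by move=> szg; apply: msize_sqr_le; rewrite (leq_trans szg) // leqW // leq_addr.
have g1_le := sqr_le _ szg1; have g2_le := sqr_le _ szg2.
exists 2%N, (fun j => if j == ord0 then g1 else g2), h; split.
- by rewrite big_ord_recl big_ord1.
- by move=> j; case: eqP.
have -> : p * h = f - (g1 ^+ 2 + g2 ^+ 2) by rewrite fE addrC addKr.
rewrite /deg_le (leq_trans (msizeD_le _ _)) // geq_max msizeN.
rewrite (leq_trans (msizeD_le _ _)) ?geq_max ?g1_le // andbT.
by rewrite (leq_trans hf) // ltnS leq_mul2l /d -addnA leq_addr.
Qed.
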